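(* Let $\mathbb F$ be a field, $\mathcal I$ an index set, and $n,m$ positive integers. Let $\mathcal A=\{A_{ij}\}_{i,j\in\mathcal I}$ be a family of $n\times n$ matrices over $\mathbb F$ and $\mathcal B=\{B_{ij}\}_{i,j\in\mathcal I}$ a family of $m\times m$ matrices over $\mathbb F$. Assume that neither $\mathcal A$ nor $\mathcal B$ is strongly reducible in the coupled sense, and that the linked graph $\mathcal G(\mathcal A,\mathcal B)$ is connected. Let $X_i$ be an $n\times m$ matrix over $\mathbb F$ for each $i\in\mathcal I$, and suppose $A_{ij}X_j=X_iB_{ij}$ for all $i,j\in\mathcal I$. Then either $X_i=0$ for all $i$, or $X_i$ is nonsingular for all $i$. In the latter case $m=n$. If $\mathcal A=\mathcal B$ is a family of complex matrices ($\mathbb F=\mathbb C$), then there is a scalar $\alpha$ such that $X_i=\alpha I_n$ for all $i$.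
   Context: The index set $\mathcal I$ may be finite or infinite. Nonsingular means square and invertible. A family $\mathcal A=\{A_{ij}\}_{i,j\in\mathcal I}$ of $n\times n$ matrices over $\mathbb F$ is strongly reducible in the coupled sense if there exist subspaces $\mathcal U_i\subseteq\mathbb F^n$ ($i\in\mathcal I$), every one of which is a nonzero proper subspace of $\mathbb F^n$, such that $A_{ij}(\mathcal U_j)\subseteq\mathcal U_i$ for all $i,j\in\mathcal I$. Similarly for $\mathcal B$ with $m$ in place of $n$. A matrix has full column rank if its columns are linearly independent (for square matrices: it is nonsingular). The digraph $\mathcal D(\mathcal A)$ has vertices $\{v_i\}_{i\in\mathcal I}$, with a directed edge from $v_i$ to $v_j$ if and only if $A_{ij}$ has full column rank; $\mathcal D(\mathcal B)$ is defined similarly, on the same vertices, from the $B_{ij}$. Two vertices are strongly connected in a digraph if there are directed walks (finite sequences of consecutive directed edges) from each to the other. The linked graph $\mathcal G(\mathcal A,\mathcal B)$ is the undirected graph on vertices $\{v_i\}_{i\in\mathcal I}$ in which $\{v_i,v_j\}$ is an edge if and only if $v_i$ and $v_j$ are strongly connected in $\mathcal D(\mathcal A)$ or strongly connected in $\mathcal D(\mathcal B)$ (or both). It is connected if any two vertices are joined by a finite path of edges. *)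

(* Defs.v *)
From Stdlib Require Import Relation_Operators.
From mathcomp Require Import all_boot all_algebra.
From mathcomp Require Export reals complex.

Set Implicit Arguments.
Unset Strict Implicit.
Unset Printing Implicit Defensive.

Import GRing.Theory.
Local Open Scope ring_scope.

(* Matrices act on column vectors, so subspaces of F^n are subspaces of
   'cV[F]_n. *)
Definition strongly_reducible (F : fieldType) (I : Type) (n : nat)
    (A : I -> I -> 'M[F]_n) : Prop :=
  exists U : I -> {vspace 'cV[F]_n},
    (forall i, U i != 0%VS /\ U i != fullv) /\
    (forall i j, (linfun (mulmx (A i j)) @: U j <= U i)%VS).

Definition full_col_rank (F : fieldType) (p q : nat) (M : 'M[F]_(p, q)) : bool :=
  row_free M^T.

Definition digraph (F : fieldType) (I : Type) (n : nat)
    (A : I -> I -> 'M[F]_n) (i j : I) : Prop :=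
  full_col_rank (A i j).

Definition strongly_connected (I : Type) (D : I -> I -> Prop) (i j : I) : Prop :=
  clos_refl_trans I D i j /\ clos_refl_trans I D j i.

(* Every vertex gets a loop, since the trivial walk makes it strongly connected
   to itself; loops do not affect connectedness. *)
Definition linked_graph (F : fieldType) (I : Type) (n m : nat)
    (A : I -> I -> 'M[F]_n) (B : I -> I -> 'M[F]_m) (i j : I) : Prop :=
  strongly_connected (digraph A) i j \/ strongly_connected (digraph B) i j.

(* For a symmetric edge relation E, as linked_graph is. *)
Definition graph_connected (I : Type) (E : I -> I -> Prop) : Prop :=
  forall i j, clos_refl_trans I E i j.

(* The cast is along a proof that X is square. *)
Definition nonsingular (F : fieldType) (n m : nat) (X : 'M[F]_(n, m)) : Prop :=
  exists e : m = n, castmx (erefl n, e) X \in unitmx.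

(* Main.v *)
Require Import Defs.
From Stdlib Require Import Relation_Operators Classical.
From mathcomp Require Import all_boot all_algebra.
From mathcomp Require Import reals complex.

(** This is a coupled form of Schur's lemma. The relation
    [A i j *m X j = X i *m B i j] says that the images of the [X i] are mapped
    into one another by [A], and their kernels by [B]. If all the [X i] have
    the same rank [r], then the images all have dimension [r] and the kernels
    all have dimension [m - r], so the absence of a coupled family of nonzero
    proper subspaces leaves only [r = 0] or [r = n] for the images, and only
    [r = m] or [r = 0] for the kernels. Hence either [r = 0] and every [X i]
    vanishes, or [r = n = m] and every [X i] is bijective ([coupled_schur]).

    The linked graph is what makes the rank constant. When [A i j] is
    injective, [X j] has the rank of [A i j *m X j = X i *m B i j], which is at
    most that of [X i]; when [B i j] is bijective, the inequality is reversed.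
    Strongly connected vertices, in either digraph, thus carry equal ranks
    ([coupled_rank_constant]).

    Finally, if [A = B] over an algebraically closed field, subtracting from
    every [X i] an eigenvalue of a single one of them preserves the
    intertwining relation and makes that one singular, so all the differences
    vanish ([coupled_schur_scalar]). *)

Set Implicit Arguments.
Unset Strict Implicit.
Unset Printing Implicit Defensive.

Import GRing.Theory.
Local Open Scope ring_scope.

Definition mxfun (F : fieldType) (p q : nat) (M : 'M[F]_(p, q)) :
    'Hom('cV[F]_q, 'cV[F]_p) := linfun (mulmx M).

Lemma mxfunE (F : fieldType) (p q : nat) (M : 'M[F]_(p, q)) v :
  mxfun M v = M *m v.
Proof. by rewrite lfunE. Qed.

Lemma mxfunM (F : fieldType) (p q r : nat) (M : 'M[F]_(p, q))
    (N : 'M[F]_(q, r)) : mxfun (M *m N) = (mxfun M \o mxfun N)%VF.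
Proof. by apply/lfunP => v; rewrite comp_lfunE !mxfunE mulmxA. Qed.

Lemma dim_cV (F : fieldType) (p : nat) : \dim {: 'cV[F]_p} = p.
Proof. by rewrite dimvf /dim /= muln1. Qed.

Lemma lker_mxfun_eq0 (F : fieldType) (p q : nat) (M : 'M[F]_(p, q)) :
  (lker (mxfun M) == 0%VS) = full_col_rank M.
Proof.
apply/idP/idP => [/lker0P injM | freeM].
  apply: inj_row_free => v vM0; apply: trmx_inj; apply: injM.
  by rewrite !mxfunE trmx0 mulmx0 -[M]trmxK -trmx_mul vM0 trmx0.
apply/lker0P => u v; rewrite !mxfunE => /(congr1 trmx); rewrite !trmx_mul.
by move/(row_free_inj freeM)/trmx_inj.
Qed.

Lemma limg_mxfun_eq0 (F : fieldType) (p q : nat) (M : 'M[F]_(p, q)) :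
  limg (mxfun M) = 0%VS -> M = 0.
Proof.
move=> img0; apply/matrixP => i j.
have : mxfun M (delta_mx j 0) \in limg (mxfun M) by rewrite memv_img ?memvf.
by rewrite img0 memv0 mxfunE -colE => /eqP/matrixP/(_ i 0); rewrite !mxE.
Qed.

Lemma nonsingular_sqE (F : fieldType) (p : nat) (M : 'M[F]_p) :
  nonsingular M <-> M \in unitmx.
Proof.
split=> [[e]|unitM]; first by rewrite (eq_axiomK e) castmx_id.
by exists erefl; rewrite castmx_id.
Qed.

Lemma clos_refl_trans_least (I : Type) (E S : I -> I -> Prop) :
    (forall i, S i i) -> (forall j i k, S i j -> S j k -> S i k) ->
    (forall i j, E i j -> S i j) ->
  forall i j, clos_refl_trans I E i j -> S i j.
Proof.
move=> Sxx Strans sES i j; elim=> [x y /sES //|x //|x y z _ Sxy _ Syz].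
exact: Strans Sxy Syz.
Qed.

(** Over an empty index set the empty family of subspaces qualifies. *)
Lemma index_inhabited (F : fieldType) (I : Type) (n : nat)
    (A : I -> I -> 'M[F]_n) : ~ strongly_reducible A -> inhabited I.
Proof.
move=> irrA; apply: NNPP => I0; apply: irrA.
by exists (fun=> 0%VS); split=> i; case: I0.
Qed.

(** Equal dimensions make the nonzero-proper condition uniform in the index:
    it can only fail for all the subspaces at once. *)
Lemma invariant_equidim (F : fieldType) (I : Type) (n d : nat)
    (A : I -> I -> 'M[F]_n) (U : I -> {vspace 'cV[F]_n}) :
    ~ strongly_reducible A ->
    (forall i j, (mxfun (A i j) @: U j <= U i)%VS) ->
    (forall i, \dim (U i) = d) ->
  d = 0%N \/ d = n.
Proof.
move=> irrA invU dimU.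
have [-> | d_neq0] := eqVneq d 0%N; first by left.
have [-> | d_neqn] := eqVneq d n; first by right.
case: irrA; exists U; split=> // i; split; last first.
  by apply: contra d_neqn => /eqP Ui; rewrite -(dimU i) Ui dim_cV.
by rewrite -dimv_eq0 dimU.
Qed.

Section CoupledSchur.

Variables (F : fieldType) (I : Type) (n m : nat).
Variables (A : I -> I -> 'M[F]_n) (B : I -> I -> 'M[F]_m).
Variable X : I -> 'M[F]_(n, m).
Hypothesis AX : forall i j, A i j *m X j = X i *m B i j.

Let mxfunAX i j :
  (mxfun (A i j) \o mxfun (X j) = mxfun (X i) \o mxfun (B i j))%VF.
Proof. by rewrite -!mxfunM AX. Qed.

Let rk i := \dim (limg (mxfun (X i))).

Let rk_digraphA i j : digraph A i j -> (rk j <= rk i)%N.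
Proof.
rewrite /digraph -lker_mxfun_eq0 => /eqP kerA0.
rewrite /rk -(@limg_dim_eq _ _ _ (mxfun (A i j)) (limg _)) ?kerA0 ?capv0 //.
by rewrite -limg_comp mxfunAX limg_comp dimvS ?limgS ?subvf.
Qed.

Let rk_digraphB i j : digraph B i j -> (rk i <= rk j)%N.
Proof.
rewrite /digraph -lker_mxfun_eq0 => /eqP kerB0.
(* An injective endomorphism of a finite-dimensional space is onto. *)
have imgB : limg (mxfun (B i j)) = fullv.
  apply/eqP; rewrite eqEdim subvf /=.
  by rewrite (@limg_dim_eq _ _ _ _ fullv) ?kerB0 ?capv0.
rewrite /rk -{1}imgB -limg_comp -mxfunAX limg_comp.
by rewrite -[leqRHS](limg_ker_dim (mxfun (A i j))) leq_addl.
Qed.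

Lemma coupled_rank_constant :
  graph_connected (linked_graph A B) ->
  forall i j, \dim (limg (mxfun (X i))) = \dim (limg (mxfun (X j))).
Proof.
move=> conn.
suff le_rk i j : (rk i <= rk j)%N.
  by move=> i j; apply/eqP; rewrite eqn_leq !le_rk.
apply: (clos_refl_trans_least (S := fun i j => (rk i <= rk j)%N)) (conn i j).
- by [].
- by move=> y x z; apply: leq_trans.
move=> {}i {}j [[_ ji]|[ij _]].
  (* Along the edges of the digraph of [A] the rank decreases, so it is the
     walk back from [j] to [i] that bounds [rk i] by [rk j]. *)
  apply: (clos_refl_trans_least (S := fun i j => (rk j <= rk i)%N)) ji.
  - by [].
  - by move=> y x z le_yx le_zy; apply: leq_trans le_zy le_yx.
  - exact: rk_digraphA.
apply: (clos_refl_trans_least (S := fun i j => (rk i <= rk j)%N)) ij.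
- by [].
- by move=> y x z; apply: leq_trans.
- exact: rk_digraphB.
Qed.

(** The images leave the common rank [0] or [n], the kernels leave [m] or [0];
    all the [X i] vanish unless the rank is [n] and the kernels are zero, and
    then rank-nullity gives [m = n]. *)
Lemma coupled_schur :
    ~ strongly_reducible A -> ~ strongly_reducible B ->
    graph_connected (linked_graph A B) ->
  (forall i, X i = 0) \/ (forall i, nonsingular (X i)).
Proof.
move=> irrA irrB conn.
have [i0] := index_inhabited irrA.
have rkE i : rk i = rk i0 by apply: coupled_rank_constant.
have rank_nullity i : (\dim (lker (mxfun (X i))) + rk i0 = m)%N.
  rewrite -(rkE i) -[RHS](dim_cV F m).
  by rewrite -(limg_ker_dim (mxfun (X i)) fullv) capfv.
have kerE i : \dim (lker (mxfun (X i))) = \dim (lker (mxfun (X i0))).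
  by apply: (@addIn (rk i0)); rewrite !rank_nullity.
have imgA i j : (mxfun (A i j) @: limg (mxfun (X j)) <= limg (mxfun (X i)))%VS.
  by rewrite -limg_comp mxfunAX limg_comp limgS ?subvf.
have kerB i j : (mxfun (B i j) @: lker (mxfun (X j)) <= lker (mxfun (X i)))%VS.
  apply/subvP => _ /memv_imgP[v /[!memv_ker] /eqP Xv0 ->].
  by rewrite -comp_lfunE -mxfunAX comp_lfunE Xv0 linear0.
have zero : rk i0 = 0%N -> forall i, X i = 0.
  move=> rk0 i; apply: limg_mxfun_eq0; apply/eqP.
  by rewrite -dimv_eq0 -/(rk i) rkE rk0.
have [rk0 | rkn] := invariant_equidim irrA imgA rkE; first by left; apply: zero.
have [ker0 | kerm] := invariant_equidim irrB kerB kerE; last first.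
  left; apply: zero; apply/eqP.
  by rewrite -(eqn_add2l m) addn0 -{1}kerm rank_nullity.
right=> i.
have e : m = n by rewrite -(rank_nullity i) kerE ker0 rkn.
exists e.
have : full_col_rank (X i) by rewrite -lker_mxfun_eq0 -dimv_eq0 kerE ker0.
move: (X i) => Y; case: n / e Y => Y.
by rewrite castmx_id /full_col_rank row_free_unit unitmx_tr.
Qed.

End CoupledSchur.

Lemma closed_field_eigenvalue (F : closedFieldType) (n : nat) (M : 'M[F]_n) :
  (0 < n)%N -> exists alpha, eigenvalue M alpha.
Proof.
move=> n_gt0; have [|alpha rootM] := closed_rootP (char_poly M) _.
  by rewrite size_char_poly; case: n n_gt0 M.
by exists alpha; rewrite eigenvalue_root_char.
Qed.

Lemma coupled_schur_scalar (F : closedFieldType) (I : Type) (n : nat)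
    (A : I -> I -> 'M[F]_n) (X : I -> 'M[F]_n) :
    (0 < n)%N -> ~ strongly_reducible A ->
    graph_connected (linked_graph A A) ->
    (forall i j, A i j *m X j = X i *m A i j) ->
  exists alpha, forall i, X i = alpha%:M.
Proof.
move=> n_gt0 irrA conn AX.
have [i0] := index_inhabited irrA.
have [alpha eigX] := closed_field_eigenvalue (X i0) n_gt0.
have AXa i j : A i j *m (X j - alpha%:M) = (X i - alpha%:M) *m A i j.
  by rewrite mulmxBr mulmxBl AX scalar_mxC.
have [X0 | unitX] := coupled_schur AXa irrA irrA conn.
  by exists alpha => i; apply/eqP; rewrite -subr_eq0 X0.
move/nonsingular_sqE: (unitX i0); rewrite -row_free_unit -kermx_eq0.
by move: eigX; rewrite /eigenvalue /eigenspace => /negPf->.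
Qed.

Theorem theorem5p2 (I : Type) (n m : nat) (hn : (0 < n)%N) (hm : (0 < m)%N) :
  (forall (F : fieldType) (A : I -> I -> 'M[F]_n) (B : I -> I -> 'M[F]_m)
      (X : I -> 'M[F]_(n, m)),
    ~ strongly_reducible A ->
    ~ strongly_reducible B ->
    graph_connected (linked_graph A B) ->
    (forall i j, A i j *m X j = X i *m B i j) ->
    ((forall i, X i = 0) \/ (forall i, nonsingular (X i))) /\
    ((forall i, nonsingular (X i)) -> m = n)) /\
  (forall (R : realType) (A B : I -> I -> 'M[R[i]]_n) (X : I -> 'M[R[i]]_n),
    A = B ->
    ~ strongly_reducible A ->
    ~ strongly_reducible B ->
    graph_connected (linked_graph A B) ->
    (forall i j, A i j *m X j = X i *m B i j) ->
    exists alpha : R[i], forall i, X i = alpha%:M).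
Proof.
split=> [F A B X irrA irrB conn AX | R A B X eqAB irrA _ conn AX].
  split; first exact: coupled_schur AX irrA irrB conn.
  by have [i0] := index_inhabited irrA; move=> /(_ i0)[].
by subst B; apply: coupled_schur_scalar hn irrA conn AX.
Qed.
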